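(* Let $\mathcal{A}$ and $\mathcal{B}$ be arbitrary categories and let $T:\mathcal{B}\to\mathcal{A}$ be left adjoint to $H:\mathcal{A}\to\mathcal{B}$. The following are equivalent: (i) $\mathcal{S}^T=\mathcal{C}^T$. (ii) $\mathcal{S}^T=\mathrm{Im}\,H$. (iii) $\mathcal{S}_H=\mathcal{C}_H$. (iv) $\mathcal{S}_H=\mathrm{Im}\,T$. (v) The functors $H$ and $T$ induce mutually inverse equivalences of categories between $\mathcal{C}_H$ and $\mathcal{C}^T$.
   Context: All subcategories are full and closed under isomorphisms. Let $\delta:T\circ H\to \mathbf{1}_{\mathcal{A}}$ and $\eta:\mathbf{1}_{\mathcal{B}}\to H\circ T$ be the counit and unit of the adjunction $T\dashv H$. $\mathrm{Im}\,H$ is the essential image of $H$ (all $Y\in\mathcal{B}$ with $Y\cong H(X)$ for some $X\in\mathcal{A}$), and similarly $\mathrm{Im}\,T\subseteq\mathcal{A}$. A morphism $\epsilon$ of $\mathcal{A}$ is an $H$-equivalence if $H(\epsilon)$ is an isomorphism; a morphism $\epsilon$ of $\mathcal{B}$ is a $T$-equivalence if $T(\epsilon)$ is an isomorphism. $\mathcal{C}_H\subseteq\mathcal{A}$ is the full subcategory of $H$-colocal objects, i.e. those $X$ such that for every $H$-equivalence $\epsilon:U\to V$ the map $\mathcal{A}(X,\epsilon):\mathcal{A}(X,U)\to\mathcal{A}(X,V)$ is bijective. $\mathcal{C}^T\subseteq\mathcal{B}$ is the full subcategory of $T$-local objects, i.e. those $Y$ such that for every $T$-equivalence $\epsilon:U\to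 V$ the map $\mathcal{B}(\epsilon,Y):\mathcal{B}(V,Y)\to\mathcal{B}(U,Y)$ is bijective. $\mathcal{S}_H=\{X\in\mathcal{A}\mid \delta_X:(T\circ H)(X)\to X\text{ is an isomorphism}\}$ and $\mathcal{S}^T=\{Y\in\mathcal{B}\mid \eta_Y:Y\to(H\circ T)(Y)\text{ is an isomorphism}\}$. ''$H$ and $T$ induce mutually inverse equivalences between $\mathcal{X}\subseteq\mathcal{A}$ and $\mathcal{Y}\subseteq\mathcal{B}$'' means that $H$ restricts to a functor $\mathcal{X}\to\mathcal{Y}$, $T$ restricts to a functor $\mathcal{Y}\to\mathcal{X}$, and these restrictions are mutually quasi-inverse equivalences. *)

(* Defs.v *)
From mathcomp Require Import all_boot.

Set Implicit Arguments.
Unset Strict Implicit.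
Unset Printing Implicit Defensive.

Record category := Category {
  obj :> Type;
  hom : obj -> obj -> Type;
  idm : forall X, hom X X;
  compose : forall X Y Z, hom Y Z -> hom X Y -> hom X Z;
  compose_id_l : forall X Y (f : hom X Y), compose (idm Y) f = f;
  compose_id_r : forall X Y (f : hom X Y), compose f (idm X) = f;
  compose_assoc : forall W X Y Z (h : hom Y Z) (g : hom X Y) (f : hom W X),
    compose h (compose g f) = compose (compose h g) f
}.

Arguments idm {c} X.

Notation "g '\oc' f" := (compose g f) (at level 40, left associativity).

Definition is_iso (C : category) (X Y : C) (f : hom X Y) : Prop :=
  exists g : hom Y X, g \oc f = idm X /\ f \oc g = idm Y.

Definition isomorphic (C : category) (X Y : C) : Prop :=
  exists f : hom X Y, is_iso f.

Record functor (C D : category) := Functor {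
  fobj :> C -> D;
  fmap : forall X Y : C, hom X Y -> hom (fobj X) (fobj Y);
  fmap_id : forall X : C, fmap (idm X) = idm (fobj X);
  fmap_compose : forall (X Y Z : C) (g : hom Y Z) (f : hom X Y),
    fmap (g \oc f) = fmap g \oc fmap f
}.

Arguments fmap {C D} f0 {X Y} f.

Definition id_functor (C : category) : functor C C :=
  @Functor C C (fun X => X) (fun X Y f => f)
    (fun X => erefl) (fun X Y Z g f => erefl).

Section CompFunctor.
Variables (C D E : category) (G : functor D E) (F : functor C D).

Fact comp_functor_id (X : C) : fmap G (fmap F (idm X)) = idm (G (F X)).
Proof. by rewrite !fmap_id. Qed.

Fact comp_functor_compose (X Y Z : C) (g : hom Y Z) (f : hom X Y) :
  fmap G (fmap F (g \oc f)) = fmap G (fmap F g) \oc fmap G (fmap F f).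
Proof. by rewrite !fmap_compose. Qed.

Definition comp_functor : functor C E :=
  @Functor C E (fun X => G (F X)) (fun X Y f => fmap G (fmap F f))
    comp_functor_id comp_functor_compose.
End CompFunctor.

Record nat_trans (C D : category) (F G : functor C D) := NatTrans {
  component :> forall X : C, hom (F X) (G X);
  naturality : forall (X Y : C) (f : hom X Y),
    component Y \oc fmap F f = fmap G f \oc component X
}.

Definition naturally_isomorphic (C D : category) (F G : functor C D) : Prop :=
  exists a : nat_trans F G, forall X : C, is_iso (a X).

Record adjunction (A B : category) (T : functor B A) (H : functor A B) :=
  Adjunction {
    adj_counit : nat_trans (comp_functor T H) (id_functor A);
    adj_unit : nat_trans (id_functor B) (comp_functor H T);
    triangle_left : forall Y : B,
      adj_counit (T Y) \oc fmap T (adj_unit Y) = idm (T Y);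
    triangle_right : forall X : A,
      fmap H (adj_counit X) \oc adj_unit (H X) = idm (H X)
  }.

(* A full subcategory is given by a predicate on objects; two of them are equal
   iff the predicates have the same extension. *)
Definition same_subcat (C : category) (P Q : C -> Prop) : Prop :=
  forall X : C, P X <-> Q X.

Definition full_subcat (C : category) (P : C -> Prop) : category :=
  @Category {X : C | P X}
    (fun X Y => hom (sval X) (sval Y))
    (fun X => idm (sval X))
    (fun X Y Z g f => g \oc f)
    (fun X Y f => compose_id_l f)
    (fun X Y f => compose_id_r f)
    (fun W X Y Z h g f => compose_assoc h g f).

Definition restrict_functor (C D : category) (F : functor C D)
    (P : C -> Prop) (Q : D -> Prop) (FPQ : forall X : C, P X -> Q (F X)) :
    functor (full_subcat P) (full_subcat Q) :=
  @Functor (full_subcat P) (full_subcat Q)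
    (fun X => exist Q (F (sval X)) (FPQ (sval X) (svalP X)))
    (fun X Y f => fmap F f)
    (fun X => fmap_id F (sval X))
    (fun X Y Z g f => fmap_compose F g f).

Definition quasi_inverse (C D : category) (F : functor C D) (G : functor D C) :
    Prop :=
  naturally_isomorphic (comp_functor G F) (id_functor C) /\
  naturally_isomorphic (comp_functor F G) (id_functor D).

(* The two natural isomorphisms are arbitrary: they are not required to be
   given by the counit and the unit of an adjunction. *)
Definition induce_inverse_equivalences (A B : category)
    (H : functor A B) (T : functor B A) (P : A -> Prop) (Q : B -> Prop) : Prop :=
  exists (HPQ : forall X : A, P X -> Q (H X))
         (TQP : forall Y : B, Q Y -> P (T Y)),
    quasi_inverse (restrict_functor HPQ) (restrict_functor TQP).

Definition ess_image (C D : category) (F : functor C D) (Y : D) : Prop :=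
  exists X : C, isomorphic Y (F X).

Definition functor_equivalence (C D : category) (F : functor C D)
    (U V : C) (e : hom U V) : Prop :=
  is_iso (fmap F e).

Definition colocal (C D : category) (F : functor C D) (X : C) : Prop :=
  forall (U V : C) (e : hom U V), functor_equivalence F e ->
    bijective (fun f : hom X U => e \oc f).

Definition local (C D : category) (F : functor C D) (Y : C) : Prop :=
  forall (U V : C) (e : hom U V), functor_equivalence F e ->
    bijective (fun f : hom V Y => f \oc e).

Definition counit_fixed (A B : category) (T : functor B A) (H : functor A B)
    (adj : adjunction T H) (X : A) : Prop :=
  is_iso (adj_counit adj X).

Definition unit_fixed (A B : category) (T : functor B A) (H : functor A B)
    (adj : adjunction T H) (Y : B) : Prop :=
  is_iso (adj_unit adj Y).

(* Main.v *)
Require Import Defs.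
From mathcomp Require Import all_boot.
From Stdlib Require Import IndefiniteDescription.

Set Implicit Arguments.
Unset Strict Implicit.
Unset Printing Implicit Defensive.

(**
  Always S^T <= Im H <= C^T and dually S_H <= Im T <= C_H. Each of the five
  conditions amounts to the adjunction being idempotent, i.e. to the unit being
  invertible on Im H, equivalently to the counit being invertible on Im T: in
  that case the unit at a T-local object is a T-equivalence between T-local
  objects, hence invertible. For (v), a quasi-inverse makes T fully faithful on
  C^T, so the counit at TY is T(r) for some r, and r is inverse to the unit at Y.
  Statements about the counit are those about the unit of the opposite
  adjunction.
*)

(** * Isomorphisms and natural isomorphisms *)

Section Isomorphisms.
Variable C : category.
Implicit Types X Y Z : C.

(** With its companion below, this is applied to the triangle identities: once one factor is
    invertible, so is the other. *)
Lemma left_inverse_is_iso X Y (g : hom Y X) (f : hom X Y) :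
  g \oc f = idm X -> is_iso f -> is_iso g.
Proof.
move=> gf [f' [f'f ff']]; exists f; split=> //.
suff -> : g = f' by [].
by rewrite -(compose_id_r g) -ff' compose_assoc gf compose_id_l.
Qed.

Lemma right_inverse_is_iso X Y (g : hom Y X) (f : hom X Y) :
  g \oc f = idm X -> is_iso g -> is_iso f.
Proof.
move=> gf [g' [g'g gg']]; exists g; split=> //.
suff -> : f = g' by [].
by rewrite -(compose_id_l f) -g'g -compose_assoc gf compose_id_r.
Qed.

Lemma is_iso_inverse X Y (f : hom X Y) (g : hom Y X) :
  g \oc f = idm X -> f \oc g = idm Y -> is_iso g.
Proof. by move=> gf fg; exists f. Qed.

Lemma isomorphic_sym X Y : isomorphic X Y -> isomorphic Y X.
Proof. by move=> [f [g [gf fg]]]; exists g; exact: is_iso_inverse gf fg. Qed.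

End Isomorphisms.

(** The componentwise inverses are only known to exist, so a choice principle is used to gather them
    into a family. *)
Lemma naturally_isomorphic_sym (C D : category) (F G : functor C D) :
  naturally_isomorphic F G -> naturally_isomorphic G F.
Proof.
move=> [a aI].
pose b X := proj1_sig (constructive_indefinite_description _ (aI X)).
have ba X : b X \oc a X = idm (F X).
  by rewrite /b; case: constructive_indefinite_description => ? [].
have ab X : a X \oc b X = idm (G X).
  by rewrite /b; case: constructive_indefinite_description => ? [].
have b_nat X Y (f : hom X Y) : b Y \oc fmap G f = fmap F f \oc b X.
  rewrite -[LHS]compose_id_r -(ab X) compose_assoc -(compose_assoc (b Y)).
  by rewrite -naturality compose_assoc ba compose_id_l.
by exists (NatTrans b_nat) => X; exists (a X).
Qed.

(** * Duality: opposite categories, functors and adjunctions *)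

Definition op_category (C : category) : category :=
  @Category C (fun X Y => hom Y X) (fun X => idm X) (fun X Y Z g f => f \oc g)
    (fun X Y f => compose_id_r f) (fun X Y f => compose_id_l f)
    (fun W X Y Z h g f => esym (compose_assoc f g h)).

Definition op_functor (C D : category) (F : functor C D) :
    functor (op_category C) (op_category D) :=
  @Functor (op_category C) (op_category D) F (fun X Y f => fmap F f)
    (fun X => fmap_id F X) (fun X Y Z g f => fmap_compose F f g).

Lemma is_iso_op (C : category) (X Y : C) (f : hom X Y) :
  @is_iso (op_category C) Y X f <-> is_iso f.
Proof. by split=> -[g [gf fg]]; exists g. Qed.

Lemma ess_image_op (C D : category) (F : functor C D) (Y : D) :
  @ess_image (op_category C) (op_category D) (op_functor F) Y
    <-> ess_image F Y.
Proof.
split=> -[X /isomorphic_sym [f fI]]; exists X; exists f; first exact/is_iso_op.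
exact: (proj2 (is_iso_op _)).
Qed.

Lemma local_op (C D : category) (F : functor C D) (X : C) :
  @local (op_category C) (op_category D) (op_functor F) X <-> colocal F X.
Proof.
by split=> XL U V e eI; apply: (XL V U e); apply/is_iso_op.
Qed.

(** Reversing arrows makes [H] the left adjoint and [T] the right one; unit and counit trade places,
    and so do the triangle identities. *)
Definition op_adjunction (A B : category) (T : functor B A) (H : functor A B)
    (adj : adjunction T H) :
    adjunction (op_functor H) (op_functor T) :=
  @Adjunction (op_category B) (op_category A)
    (op_functor H) (op_functor T)
    (@NatTrans (op_category B) (op_category B)
      (comp_functor (op_functor H) (op_functor T)) (id_functor _)
      (fun Y => adj_unit adj Y)
      (fun X Y f => esym (naturality (adj_unit adj) f)))
    (@NatTrans (op_category A) (op_category A)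
      (id_functor _) (comp_functor (op_functor T) (op_functor H))
      (fun X => adj_counit adj X)
      (fun X Y f => esym (naturality (adj_counit adj) f)))
    (triangle_right adj) (triangle_left adj).

(** * Unit-fixed objects, the image of [H] and [T]-local objects *)

Section UnitSide.
Variables (A B : category) (T : functor B A) (H : functor A B).
Variable adj : adjunction T H.

Local Notation eta := (adj_unit adj).
Local Notation delta := (adj_counit adj).

Lemma unit_natural {X Y : B} (f : hom X Y) :
  eta Y \oc f = fmap H (fmap T f) \oc eta X.
Proof. exact: (naturality eta f). Qed.

Lemma counit_natural {X Y : A} (f : hom X Y) :
  delta Y \oc fmap T (fmap H f) = f \oc delta X.
Proof. exact: (naturality delta f). Qed.

Lemma unit_fixed_ess_image (Y : B) : unit_fixed adj Y -> ess_image H Y.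
Proof. by move=> YI; exists (T Y), (eta Y). Qed.

(** One half of the hom-set bijection of the adjunction: a map into [H X] is recovered from its
    transpose [T Y -> X]. *)
Lemma transposeK (X : A) (Y : B) (f : hom Y (H X)) :
  fmap H (delta X \oc fmap T f) \oc eta Y = f.
Proof.
rewrite fmap_compose -compose_assoc -unit_natural compose_assoc.
by rewrite triangle_right compose_id_l.
Qed.

(** Under transposition, precomposition with [e] becomes precomposition with [fmap T e], which is
    undone by precomposing with its inverse [t]. *)
Lemma image_local (X : A) : local T (H X).
Proof.
move=> U V e [t [te et]].
exists (fun f => fmap H (delta X \oc fmap T f \oc t) \oc eta V) => f /=.
  by rewrite (fmap_compose T) -!compose_assoc et compose_id_r transposeK.
rewrite -compose_assoc unit_natural compose_assoc -fmap_compose.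
by rewrite -(compose_assoc _ t) te compose_id_r transposeK.
Qed.

Lemma isomorphic_local (X Y : B) : isomorphic X Y -> local T Y -> local T X.
Proof.
move=> [i [j [ji ij]]] YL U V e /YL [g gK Kg].
exists (fun f => j \oc g (i \oc f)) => f.
  by rewrite compose_assoc gK compose_assoc ji compose_id_l.
by rewrite -compose_assoc Kg compose_assoc ji compose_id_l.
Qed.

Lemma ess_image_local (Y : B) : ess_image H Y -> local T Y.
Proof. by move=> [X YX]; apply: isomorphic_local YX (image_local X). Qed.

Lemma unit_fixed_local_ess_image :
  same_subcat (unit_fixed adj) (local T) ->
  same_subcat (unit_fixed adj) (ess_image H).
Proof.
move=> SL Y; split; first exact: unit_fixed_ess_image.
by move/ess_image_local/SL.
Qed.

Lemma counit_fixed_image :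
  (forall X, unit_fixed adj (H X)) -> forall Y, counit_fixed adj (T Y).
Proof.
move=> etaH Y; exists (fmap T (eta Y)); split;
  last exact: (triangle_left adj Y).
(* H(delta_TY) is invertible, so its two right inverses H T eta_Y and
   eta_(HTY) agree. *)
have HTeta : fmap H (fmap T (eta Y)) = eta (H (T Y)).
  have [d [dd _]] := left_inverse_is_iso (triangle_right adj (T Y))
    (etaH (T Y)).
  rewrite -[LHS]compose_id_l -[RHS]compose_id_l -dd -!compose_assoc.
  by rewrite triangle_right -fmap_compose triangle_left fmap_id.
(* Naturality of [delta] at [fmap T (eta Y)] turns the remaining composite into a triangle identity
   at [H (T Y)]. *)
by rewrite -counit_natural HTeta triangle_left.
Qed.

Lemma local_unit_fixed :
  (forall Y, counit_fixed adj (T Y)) -> forall Y, local T Y -> unit_fixed adj Y.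
Proof.
move=> deltaT Y YL.
have etaE : functor_equivalence T (eta Y).
  exact: right_inverse_is_iso (triangle_left adj Y) (deltaT Y).
have [g _ gK] := YL _ _ _ etaE.
(* The inverse is the extension of [idm Y] along [eta Y]. That it is also a right inverse can be
   tested after precomposing with [eta Y], because [H (T Y)] is local. *)
exists (g (idm Y)); split; first exact: gK.
have /bij_inj inj_eta := image_local (T Y) etaE.
by apply: inj_eta; rewrite -compose_assoc gK compose_id_r compose_id_l.
Qed.

Lemma unit_fixed_local :
  (forall Y, counit_fixed adj (T Y)) ->
  same_subcat (unit_fixed adj) (local T).
Proof.
move=> deltaT Y; split; last exact: local_unit_fixed.
by move/unit_fixed_ess_image/ess_image_local.
Qed.

Lemma ess_image_unit_fixed :
  same_subcat (unit_fixed adj) (ess_image H) -> forall X, unit_fixed adj (H X).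
Proof.
move=> SH X; apply/SH; exists X, (idm (H X)), (idm (H X)).
by rewrite compose_id_l.
Qed.

End UnitSide.

(** * The counit side by duality, and the induced equivalence *)

Section Equivalences.
Variables (A B : category) (T : functor B A) (H : functor A B).
Variable adj : adjunction T H.

Local Notation eta := (adj_unit adj).
Local Notation delta := (adj_counit adj).

Lemma unit_fixed_op (X : A) :
  unit_fixed (op_adjunction adj) X <-> counit_fixed adj X.
Proof. exact: is_iso_op. Qed.

Lemma counit_fixed_op (Y : B) :
  counit_fixed (op_adjunction adj) Y <-> unit_fixed adj Y.
Proof. exact: is_iso_op. Qed.

Lemma image_colocal (Y : B) : colocal H (T Y).
Proof. exact/local_op/(image_local (op_adjunction adj)). Qed.

Lemma unit_fixed_image :
  (forall Y, counit_fixed adj (T Y)) -> forall X, unit_fixed adj (H X).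
Proof.
move=> deltaT X; apply/counit_fixed_op.
have deltaT' Y : unit_fixed (op_adjunction adj) (op_functor T Y).
  exact: (proj2 (unit_fixed_op (T Y)) (deltaT Y)).
exact: (counit_fixed_image deltaT').
Qed.

Lemma counit_fixed_colocal :
  (forall X, unit_fixed adj (H X)) ->
  same_subcat (counit_fixed adj) (colocal H).
Proof.
move=> etaH X; rewrite -unit_fixed_op -local_op.
apply: unit_fixed_local => Y; exact: (proj2 (counit_fixed_op (H Y)) (etaH Y)).
Qed.

Lemma counit_fixed_colocal_ess_image :
  same_subcat (counit_fixed adj) (colocal H) ->
  same_subcat (counit_fixed adj) (ess_image T).
Proof.
move=> SC X; rewrite -unit_fixed_op -ess_image_op.
apply: unit_fixed_local_ess_image => Y.
by rewrite unit_fixed_op local_op.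
Qed.

Lemma ess_image_counit_fixed :
  same_subcat (counit_fixed adj) (ess_image T) ->
  forall Y, counit_fixed adj (T Y).
Proof.
move=> ST Y; apply/unit_fixed_op; apply: ess_image_unit_fixed => X.
by rewrite unit_fixed_op ess_image_op.
Qed.

Lemma idempotent_equivalences :
  (forall Y, counit_fixed adj (T Y)) ->
  induce_inverse_equivalences H T (colocal H) (local T).
Proof.
move=> deltaT; have etaH := unit_fixed_image deltaT.
exists (fun X _ => image_local adj X), (fun Y _ => image_colocal Y).
split.
  unshelve eexists.
    by exists (fun X => delta (sval X)) => X Y f;
       exact: (counit_natural adj (f : hom (sval X) (sval Y))).
  by move=> X; exact: (proj2 (counit_fixed_colocal etaH _) (svalP X)).
(* The unit points from the identity to the composite, opposite to the required direction. *)
apply: naturally_isomorphic_sym; unshelve eexists.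
  by exists (fun Y => eta (sval Y)) => X Y f;
     exact: (unit_natural adj (f : hom (sval X) (sval Y))).
by move=> Y; exact: (local_unit_fixed deltaT (svalP Y)).
Qed.

End Equivalences.

(** * Quasi-inverse functors are fully faithful; recovering the fixed objects *)

(** Conjugating [fmap G (fmap F f)] by the natural isomorphism gives back [f]. *)
Lemma left_quasi_inverse_faithful (C D : category) (F : functor C D)
    (G : functor D C) :
  naturally_isomorphic (comp_functor G F) (id_functor C) ->
  forall (X Y : C) (f g : hom X Y), fmap F f = fmap F g -> f = g.
Proof.
move=> [a aI] X Y f g Ffg.
have [b [_ ab]] := aI X.
have nat_a (h : hom X Y) : a Y \oc fmap G (fmap F h) = h \oc a X.
  exact: (naturality a h).
rewrite -(compose_id_r f) -(compose_id_r g) -ab !compose_assoc.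
by rewrite -!nat_a Ffg.
Qed.

Lemma quasi_inverse_full (C D : category) (F : functor C D) (G : functor D C) :
  quasi_inverse F G ->
  forall (X Y : C) (f : hom (F X) (F Y)), exists g : hom X Y, fmap F g = f.
Proof.
move=> [GF FG] X Y f.
have [a aI] := GF; have [b [ba _]] := aI X; have [c [ca _]] := aI Y.
exists (a Y \oc fmap G f \oc b).
(* [G] is faithful as well, so it suffices to compare images under [G]; there [a Y] can be
   cancelled. *)
apply: (left_quasi_inverse_faithful FG).
have nat_a (h : hom X Y) : a Y \oc fmap G (fmap F h) = h \oc a X.
  exact: (naturality a h).
rewrite -[LHS]compose_id_l -[RHS]compose_id_l -ca -!compose_assoc.
by congr (_ \oc _); rewrite nat_a -!compose_assoc ba compose_id_r.
Qed.

Lemma equivalences_unit_fixed (A B : category) (T : functor B A)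
    (H : functor A B) (adj : adjunction T H) :
  induce_inverse_equivalences H T (colocal H) (local T) ->
  same_subcat (unit_fixed adj) (local T).
Proof.
move=> [HPQ [TQP [TH HT]]] Y; split.
  by move/unit_fixed_ess_image/(ess_image_local adj).
move=> YL; have HTYL := HPQ _ (TQP _ YL).
pose Y' : full_subcat (local T) := exist _ Y YL.
pose HTY' : full_subcat (local T) := exist _ (H (T Y)) HTYL.
(* Both [H (T Y)] and [Y] are [T]-local, so fullness of the restricted [T] applies to the counit. *)
have [r Tr] : exists r : hom (H (T Y)) Y, fmap T r = adj_counit adj (T Y).
  exact: (@quasi_inverse_full _ _ _ _ (conj HT TH) HTY' Y'
    (adj_counit adj (T Y))).
exists r; split.
  (* After applying the faithful restriction of [T], this is the left triangle identity; the other
     composite reduces to the right one by naturality of the unit. *)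
  apply: (@left_quasi_inverse_faithful _ _ _ _ HT Y' Y').
  by rewrite /= fmap_compose Tr triangle_left fmap_id.
rewrite unit_natural Tr; exact: (triangle_right adj (T Y)).
Qed.

Theorem theorem2p5 (A B : category) (T : functor B A) (H : functor A B)
    (adj : adjunction T H) :
  [<-> same_subcat (unit_fixed adj) (local T);
       same_subcat (unit_fixed adj) (ess_image H);
       same_subcat (counit_fixed adj) (colocal H);
       same_subcat (counit_fixed adj) (ess_image T);
       induce_inverse_equivalences H T (colocal H) (local T)].
Proof.
tfae.
- exact: unit_fixed_local_ess_image.
- by move/ess_image_unit_fixed/counit_fixed_colocal.
- exact: counit_fixed_colocal_ess_image.
- by move/ess_image_counit_fixed/idempotent_equivalences.
- exact: equivalences_unit_fixed.
Qed.
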